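(* Every hereditarily GO-space is homeomorphic to a countable successor ordinal, considered as a LOTS (that is, endowed with its order topology). Conversely, every countable successor ordinal with its order topology is a hereditarily GO-space.
   Context: All topological spaces are assumed to be Hausdorff (so a ''continuous image of $X$'' means a Hausdorff space $Y$ for which there is a continuous surjection $X\to Y$). A linearly ordered topological space (LOTS) is a topological space $L$ for which there is a linear order $\le^L$ on $L$ whose order topology (the topology generated by the open intervals and open rays of $\le^L$, for which the open convex sets form a base) is the topology of $L$. A generalized ordered space (GO-space) is a topological space homeomorphic to a subspace (with the subspace topology) of a LOTS. A space $X$ is called a hereditarily GO-space if every continuous image of $X$ (in particular, $X$ itself) is a GO-space. A countable successor ordinal is an ordinal of the form $\alpha+1$ with $\alpha$ a countable (possibly finite) ordinal. *)

(* Defs.v *)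
From HB Require Import structures.
From mathcomp Require Import all_boot all_order.
From mathcomp Require Import all_classical wochoice topology.

Set Implicit Arguments.
Unset Strict Implicit.
Unset Printing Implicit Defensive.

Import Order.TTheory.

Local Open Scope classical_set_scope.

Definition homeomorphic (X Y : topologicalType) : Prop :=
  exists (f : X -> Y) (g : Y -> X),
    [/\ continuous f, continuous g, cancel f g & cancel g f].

(* A LOTS is an [orderTopologicalType]; [set_type A] carries the subspace
   topology. *)
Definition GO_space (X : topologicalType) : Prop :=
  exists (d : Order.disp_t) (L : orderTopologicalType d) (A : set L),
    homeomorphic X (set_type A).

Definition continuous_image (X Y : topologicalType) : Prop :=
  exists2 f : X -> Y, continuous f & set_surj [set: X] [set: Y] f.

(* All spaces considered are Hausdorff, both [X] and its continuous images. *)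
Definition hereditarily_GO_space (X : topologicalType) : Prop :=
  hausdorff_space X /\
  forall Y : topologicalType,
    hausdorff_space Y -> continuous_image X Y -> GO_space Y.

(* Ordinals are represented by well-ordered types. *)
Definition countable_ordinal (d : Order.disp_t) (alpha : orderType d) : Prop :=
  well_order (<=%O : rel alpha) /\ countable [set: alpha].

(* The ordinal alpha + 1: the elements of alpha with [None] added on top. *)
Definition ordinal_succ (T : Type) : Type := option T.

Section OrdinalSucc.
Context {d : Order.disp_t} {alpha : orderType d}.

HB.instance Definition _ := Choice.on (ordinal_succ alpha).

Definition le_succ (x y : ordinal_succ alpha) : bool :=
  match x, y with
  | _, None => true
  | None, Some _ => false
  | Some a, Some b => (a <= b)%O
  end.

Fact le_succ_refl : reflexive le_succ.
Proof. by case=> //= a; exact: lexx. Qed.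

Fact le_succ_anti : antisymmetric le_succ.
Proof. by case=> [a|] [b|] //= /le_anti ->. Qed.

Fact le_succ_trans : transitive le_succ.
Proof. by case=> [b|] [a|] [c|] //=; exact: le_trans. Qed.

HB.instance Definition _ := Order.Le_isPOrder.Build d (ordinal_succ alpha)
  le_succ_refl le_succ_anti le_succ_trans.

Fact le_succ_total : total (<=%O : rel (ordinal_succ alpha)).
Proof. by case=> [a|] [b|] //; exact: (le_total a b). Qed.

HB.instance Definition _ :=
  Order.POrder_isTotal.Build d (ordinal_succ alpha) le_succ_total.

End OrdinalSucc.

(* Main.v *)
Require Import Defs.
From HB Require Import structures.
From mathcomp Require Import all_boot all_order all_algebra.
From mathcomp Require Import all_classical wochoice reals constructive_ereal.
From mathcomp Require Import topology normedtype.
From mathcomp Require Import ring lra.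
From mathcomp Require Import Rstruct Rstruct_topology.
From mathcomp Require Import sequences lebesgue_measure.

(* A hereditarily GO-space X is shown to be countable and compact; a countable
   compact Hausdorff space is a countable successor ordinal (Mazurkiewicz and
   Sierpinski), and so is every continuous Hausdorff image of such an ordinal.

   Three spaces that are not GO restrict X: the one-point compactification of
   an uncountable discrete set, a countable space with one non-isolated point
   whose neighborhoods are given by a free ultrafilter, and the circle. Since X
   has no image of these kinds, every disjoint family of clopen sets of X is
   countable, every countable clopen cover has a finite subcover, and X does
   not map onto [0, 1]. A dense relation inside the strict order of X gives a
   monotone map onto a dense subset of [0, 1], and a missed value of this map
   gives a clopen initial segment. Hence any two points are separated by such a
   segment; using these separations, the segment at a missed value splits into
   infinitely many clopen pieces, so there is in fact no dense relation at all.
   But "[x, y] is uncountable" would be one if X were uncountable, as every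
   subset of X has a countable cofinal subset by the countable chain condition.
   Compactness follows from countability and the covering property. *)

Set Implicit Arguments.
Unset Strict Implicit.
Unset Printing Implicit Defensive.

Import Order.TTheory GRing.Theory Num.Theory.
Import numFieldNormedType.Exports.

Local Open Scope classical_set_scope.

(** * Countable compact spaces are countable successor ordinals *)

Lemma clopenI (X : topologicalType) : setI_closed (@clopen X).
Proof. by move=> A B [oA cA] [oB cB]; split; [exact: openI|exact: closedI]. Qed.

Lemma clopenT (X : topologicalType) : clopen [set: X].
Proof. by split; [exact: openT|exact: closedT]. Qed.

Lemma clopen0 (X : topologicalType) : clopen (@set0 X).
Proof. by split; [exact: open0|exact: closed0]. Qed.

Lemma clopen_bigsetU (X : topologicalType) (F : nat -> set X) n :
  (forall k, clopen (F k)) -> clopen (\big[setU/set0]_(k < n) F k).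
Proof.
move=> clF; apply: (big_ind clopen) => //; first exact: clopen0.
by move=> A B [oA cA] [oB cB]; split; [exact: openU|exact: closedU].
Qed.

Definition has_clopen_base (X : topologicalType) :=
  forall (x : X) (U : set X), nbhs x U ->
    exists V, [/\ clopen V, V x & V `<=` U].

(** Countable sets have Lebesgue measure 0, the unit interval has measure 1. *)
Lemma countable_misses_unit_itv (R : realType) (A : set R) :
  countable A -> exists2 r : R, (0 < r < 1)%R & ~ A r.
Proof.
move=> ctA; apply: contrapT => nA.
have sub : `]0%R, 1%R[%classic `<=` A.
  move=> r /=; rewrite in_itv /= => r01; apply: contrapT => nAr.
  by apply: nA; exists r.
have := countable_lebesgue_measure0 (sub_countable (subset_card_le sub) ctA).
rewrite lebesgue_measure_itv /= lte_fin ltr01 oppr0 adde0.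
by move=> /eqP; rewrite eqe oner_eq0.
Qed.

(** * Zero-dimensionality and scatteredness of countable compact spaces *)

Section CountableCompact.
Variable X : topologicalType.
Hypotheses (X_haus : hausdorff_space X) (X_cpt : compact [set: X])
  (X_ctbl : countable [set: X]).

(* A Urysohn function with countable range misses some level. *)
Lemma countable_compact_clopen_base : has_clopen_base X.
Proof.
move=> x U; rewrite nbhsE => -[O [oO Ox] OU].
have clO : closed (~` O) by exact: open_closedC.
have nOx : ~ (~` O) x by [].
have := @normal_completely_regular Rdefinitions.R _
  (compact_normal X_haus X_cpt) (hausdorff_accessible X_haus) _ _ clO nOx.
move=> /(@uniform_separatorP _ Rdefinitions.R) [f [cf _ f0 f1]].
have [r /andP[r0 r1] nr] := countable_misses_unit_itv
  (sub_countable (card_image_le f setT) X_ctbl).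
have fNr y : f y != r by apply/eqP => fy; apply: nr; exists y.
(* As [r] is not a value, the open and the closed sublevel set agree. *)
have lt_le : f @^-1` [set y | (y < r)%R] = f @^-1` [set y | (y <= r)%R].
  apply/seteqP; split=> y /=; first exact: ltW.
  by rewrite le_eqVlt (negPf (fNr y)).
exists (f @^-1` [set y | (y < r)%R]); split.
- split; first by apply: open_comp => // ? _; exact: cf.
  by rewrite lt_le; apply: preimage_closed => //; exact: closed_le.
- by have /= -> := f0 (f x) (ex_intro2 _ _ x erefl erefl).
- move=> y /= fyr; apply: OU; apply: contrapT => nOy.
  have /= fy1 := f1 (f y) (ex_intro2 _ _ y nOy erefl).
  by move: fyr; rewrite fy1 => /lt_trans /(_ r1); rewrite ltxx.
Qed.

(* Baire: otherwise a decreasing sequence of clopen sets that meet [F]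
   successively avoids all points of [X]. *)
Lemma countable_compact_scattered (F : set X) : closed F -> F !=set0 ->
  exists2 p, F p & exists W, clopen W /\ W `&` F = [set p].
Proof.
move=> clF [p0 Fp0]; apply: contrapT => noiso.
have [e einj] := countable_injP _ X_ctbl.
pose S := {W : set X | clopen W /\ W `&` F !=set0}.
have S0 : S by exists setT; split; [exact: clopenT|exists p0].
have step (z : X) (W : S) : exists W' : S,
    projT1 W' `<=` projT1 W /\ ~ projT1 W' z.
  case: W => W /= [clW [y [Wy Fy]]].
  suff [q [Wq Fq qz]] : exists q, [/\ W q, F q & q <> z].
    have [V [clV Vq Vz]] : exists V, [/\ clopen V, V q & V `<=` ~` [set z]].
      apply: countable_compact_clopen_base; apply: open_nbhs_nbhs; split => //.
      apply: closed_openC; apply: accessible_closed_set1.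
      exact: hausdorff_accessible.
    unshelve eexists; first exists (W `&` V).
      by split; [exact: clopenI|exists q].
    by split => /=; [exact: subIsetl|move=> [_ /Vz] /=; apply].
  apply: contrapT => nq; apply: noiso.
  have only q : W q -> F q -> q = z.
    by move=> Wq Fq; apply: contrapT => qz; apply: nq; exists q.
  exists y => //; exists W; split => //; apply/seteqP; split => q /=.
    by move=> [Wq Fq]; rewrite (only q)// (only y).
  by move=> ->.
(* The counter makes stage [n] remove the point with code [n], if there is one. *)
have stepn (nW : nat * S) : {nW' : nat * S | [/\ nW'.1 = nW.1.+1,
    projT1 nW'.2 `<=` projT1 nW.2 &
    forall z, e z = nW.1 -> ~ projT1 nW'.2 z]}.
  apply: cid; have [[z ez]|nz] := pselect (exists z, e z = nW.1).
    have [W' [W'W nW'z]] := step z nW.2; exists (nW.1.+1, W'); split => //.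
    by move=> z' ez'; rewrite (einj z' z) ?inE// ez ez'.
  by exists (nW.1.+1, nW.2); split => // z ez; exfalso; apply: nz; exists z.
have [f [f0 fS]] := dependent_choice stepn (0%N, S0).
have f1 n : (f n).1 = n.
  by elim: n => [|n IH]; [rewrite f0|case: (fS n) => -> _ _; rewrite IH].
pose W n := projT1 (f n).2.
have WS m n : (m <= n)%N -> W n `<=` W m.
  elim: n => [|n IH]; first by rewrite leqn0 => /eqP ->.
  rewrite leq_eqVlt ltnS => /orP[/eqP ->//|/IH]; apply: subset_trans.
  by case: (fS n).
have WF n : W n `&` F !=set0 by rewrite /W; case: (f n).2 => ? [].
have FF : ProperFilter (filter_from setT (fun n => W n `&` F)).
  apply: filter_from_proper; last by move=> n _; exact: WF.
  apply: filter_from_filter; first by exists 0%N.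
  move=> m n _ _; exists (maxn m n) => // y [Wy Fy].
  by split; split => //; apply: WS Wy; rewrite ?leq_maxl ?leq_maxr.
(* A cluster point [p] lies in every closed [W n], but stage [e p] removed it. *)
have [|p [_ clp]] := X_cpt FF; first by exists 0%N.
suff : W (e p).+1 p by have [_ _] := fS (e p); apply; rewrite f1.
have clW : closed (W (e p).+1) by rewrite /W; case: (f _).2 => ? [[]].
apply: clW => V Vp.
by have [|q [[Wq _] Vq]] := clp (W (e p).+1 `&` F) V _ Vp;
  [exists (e p).+1|exists q].
Qed.
End CountableCompact.

(** Reflexivity, totality and transitivity on [U] follow from least elements of sets of at most
    three points. *)
Definition well_orders_on (T : Type) (U : set T) (le : T -> T -> Prop) :=
  (forall A, A `<=` U -> A !=set0 ->
    exists2 m, A m & forall a, A a -> le m a) /\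
  (forall x y, U x -> U y -> le x y -> le y x -> x = y).

(** In an ordinal the closed initial segments are clopen; for compact spaces this condition
    determines the order topology. *)
Definition ordinal_like (X : topologicalType) (U : set X) :=
  exists2 le, well_orders_on U le &
    forall x, U x -> clopen [set y | U y /\ le y x].

(** * Assembling ordinal-like sets *)

Section OrdinalLike.
Variable X : topologicalType.
Implicit Types U V : set X.

Lemma ordinal_like_clopenI U V :
  ordinal_like U -> clopen V -> ordinal_like (U `&` V).
Proof.
move=> [le [lemin leanti] lecl] clV; exists le.
  split=> [A AUV|x y [Ux _] [Uy _]]; last exact: leanti.
  by apply: lemin => x /AUV[].
move=> x [Ux Vx].
rewrite (_ : [set _ | _] = [set y | U y /\ le y x] `&` V).
  by apply: clopenI => //; exact: lecl.
by apply/seteqP; split=> y /=; tauto.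
Qed.

(** The pieces are ordered one after another as an ordinal sum. An initial segment ending in [C n]
    consists of the finitely many earlier pieces and a segment of [C n]. *)
Lemma ordinal_like_bigcup (C : nat -> set X) : trivIset setT C ->
  (forall n, clopen (C n)) -> (forall n, ordinal_like (C n)) ->
  ordinal_like (\bigcup_n C n).
Proof.
move=> trivC clC olC.
have {}olC n : exists le, well_orders_on (C n) le /\
    forall x, C n x -> clopen [set y | C n y /\ le y x].
  by case: (olC n) => le ? ?; exists le.
have [le leC] := boolp.choice olC.
have uniC m n x : C m x -> C n x -> m = n.
  by move=> Cm Cn; apply: (trivC m n I I); exists x.
pose sumle x y := exists m n, [/\ C m x, C n y &
  (m < n)%N \/ m = n /\ le n x y].
exists sumle.
  split=> [A AC [a0 Aa0]|x y _ _].
    pose P n := `[< exists2 a, A a & C n a >].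
    have exP : exists n, P n.
      by have [n _ Cn] := AC _ Aa0; exists n; apply/asboolP; exists a0.
    case: (ex_minnP exP) => n /asboolP[a Aa Ca] nmin.
    have [[lemin _] _] := leC n.
    have [||m [Am Cm] mmin] := lemin (A `&` C n).
    - by move=> ? [].
    - by exists a.
    exists m => // b Ab; have [k _ Ck] := AC _ Ab; exists n, k; split => //.
    have := nmin k; rewrite leq_eqVlt => /(_ _)/orP[|/eqP nk|]; last by left.
      by apply/asboolP; exists b.
    by right; split => //; subst k; exact: mmin.
  move=> [m [n [Cmx Cny le1]]] [n' [m' [Cny' Cmx' le2]]].
  have ? := uniC _ _ _ Cmx' Cmx; have ? := uniC _ _ _ Cny' Cny; subst m' n'.
  case: le1 le2 => [mn|[mn le1]] [nm|[nm le2]].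
  - by have := ltn_trans mn nm; rewrite ltnn.
  - by move: mn; rewrite nm ltnn.
  - by move: nm; rewrite mn ltnn.
  - by subst m; have [[_ anti] _] := leC n; exact: anti.
move=> x [n _ Cx].
rewrite (_ : [set _ | _] =
    (\big[setU/set0]_(k < n) C k) `|` [set y | C n y /\ le n y x]).
  have [o1 c1] := clopen_bigsetU n clC.
  have [o2 c2] : clopen [set y | C n y /\ le n y x].
    by case: (leC n) => _; apply.
  by split; [exact: openU|exact: closedU].
rewrite -bigcup_mkord; apply/seteqP; split=> y /=.
  move=> [_ [m [n' [Cm Cn']]]]; have ? := uniC _ _ _ Cn' Cx; subst n'.
  by move=> [mn|[mn le1]]; [left; exists m|right; subst m].
move=> [[m /= mn Cm]|[Cy le1]].
  by split; [exists m|exists m, n; split => //; left].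
by split; [exists n|exists n, n; split => //; right].
Qed.

(** With [p] placed on top, its initial segment is the clopen set [U], and the other segments do not
    change. *)
Lemma ordinal_like_add_top U p :
  clopen U -> U p -> ordinal_like (U `\ p) -> ordinal_like U.
Proof.
move=> clU Up [le [lemin leanti] lecl].
exists (fun x y => y = p \/ x <> p /\ y <> p /\ le x y).
  split=> [A AU [a0 Aa0]|x y Ux Uy].
    have [[a Aa ap]|nA] := pselect (exists2 a, A a & a <> p).
      have [||m [Am mp] mmin] := lemin (A `\ p); last first.
      - exists m => // b Ab; have [->|bp] := pselect (b = p); first by left.
        by right; split => //; split => //; exact: mmin.
      - by exists a.
      - by move=> b [Ab bp]; split => //; exact: AU.
    exists a0 => // b Ab; left; apply: contrapT => bp.
    by apply: nA; exists b.
  move=> [->|[xp [yp le1]]] [xE|[yp' [xp' le2]]] //.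
  exact: (leanti x y (conj Ux xp) (conj Uy yp)).
move=> x Ux; have [->|xp] := pselect (x = p).
  rewrite (_ : [set _ | _] = U)//.
  by apply/seteqP; split=> y /=; [case|move=> Uy; split => //; left].
rewrite (_ : [set _ | _] = [set y | (U `\ p) y /\ le y x]); first exact: lecl.
by apply/seteqP; split=> y /=; tauto.
Qed.

(** Countably many clopen ordinal-like pieces cover [U]. Subtracting the earlier pieces from each
    makes them disjoint, and their ordinal sum orders [U]. *)
Lemma ordinal_like_countable U : countable U ->
  (forall x, U x -> exists V, [/\ clopen V, V x, V `<=` U & ordinal_like V]) ->
  ordinal_like U.
Proof.
move=> /countable_injP[e einj] locU.
have ol0 : ordinal_like (@set0 X).
  exists (fun _ _ => True) => //; split => // A A0 [a /A0]//.
have /boolp.choice[D DP] n : exists D, [/\ clopen D, ordinal_like D,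
    D `<=` U & forall x, U x -> e x = n -> D x].
  have [[x [Ux ex]]|nx] := pselect (exists x, U x /\ e x = n); last first.
    exists set0; split => //; first exact: clopen0.
    by move=> x Ux ex; apply: nx; exists x.
  have [V [clV Vx VU olV]] := locU _ Ux; exists V; split => // y Uy ey.
  by rewrite (einj y x) ?inE// ex ey.
rewrite (_ : U = \bigcup_n seqDU D n).
  have clD n : clopen (~` \big[setU/set0]_(k < n) D k).
    by apply: clopenC => //; apply: clopen_bigsetU => k; case: (DP k).
  apply: ordinal_like_bigcup; first exact: trivIset_seqDU.
    by move=> n; rewrite /seqDU setDE; apply: clopenI => //; case: (DP n).
  move=> n; rewrite /seqDU setDE; apply: ordinal_like_clopenI => //.
  by case: (DP n).
rewrite -seqDU_bigcup_eq; apply/seteqP; split=> [x Ux|x [n _]].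
  by exists (e x) => //; case: (DP (e x)) => _ _ _; exact.
by case: (DP n) => _ _ + _; exact.
Qed.

Hypotheses (X_haus : hausdorff_space X) (X_cpt : compact [set: X])
  (X_ctbl : countable [set: X]).

(** The points without a clopen ordinal-like neighborhood form a closed set. An isolated point [p]
    of it would have a clopen [W] all of whose other points are good, so that [W] is ordinal-like
    with [p] on top. *)
Lemma countable_compact_ordinal_like : ordinal_like [set: X].
Proof.
pose good x := exists V, [/\ clopen V, V x & ordinal_like V].
have base := countable_compact_clopen_base X_haus X_cpt X_ctbl.
suff allgood x : good x.
  apply: ordinal_like_countable => // x _.
  by have [V [? ? ?]] := allgood x; exists V.
apply: contrapT => ngx.
have clF : closed (~` [set x | good x]).
  apply: open_closedC; rewrite openE => y [V [clV Vy olV]].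
  rewrite /interior/= nbhsE; exists V; first by split => //; case: clV.
  by move=> z Vz; exists V.
have [|p ngp [W [clW WF]]] :=
  countable_compact_scattered X_haus X_cpt X_ctbl clF; first by exists x.
have [Wp _] : (W `&` ~` [set x | good x]) p by rewrite WF.
apply: ngp; exists W; split => //; apply: (ordinal_like_add_top clW Wp).
apply: ordinal_like_countable.
  exact: sub_countable (subset_card_le (@subsetT _ _)) X_ctbl.
move=> y [Wy yp].
have [V [clV Vy olV]] : good y.
  apply: contrapT => ngy; apply: yp.
  by have : (W `&` ~` [set x | good x]) y by []; rewrite WF.
have [V' [clV' V'y V'p]] : exists V', [/\ clopen V', V' y & V' `<=` ~` [set p]].
  apply: base; apply: open_nbhs_nbhs; split => //.
  apply: closed_openC; apply: accessible_closed_set1.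
  exact: hausdorff_accessible.
exists (V `&` (V' `&` W)); split => //.
- by apply: clopenI => //; exact: clopenI.
- by move=> z [_ [/V'p zp Wz]].
- by apply: ordinal_like_clopenI => //; exact: clopenI.
Qed.

End OrdinalLike.

(** * From a well-ordering relation to an order type *)

Section WellOrderedType.
Variables (T : choiceType) (le : T -> T -> Prop).
Hypothesis le_wo : well_orders_on [set: T] le.

(** Mentioning [le_wo] lets the order structure of the alias depend on [le]. *)
Definition wo_type : Type := let _ := le_wo in T.

HB.instance Definition _ := Choice.copy wo_type T.

Let leb (x y : wo_type) : bool := `[< le x y >].

Let le_min (A : set T) : A !=set0 -> exists2 m, A m & forall a, A a -> le m a.
Proof. by apply: (proj1 le_wo). Qed.

Lemma wo_refl x : le x x.
Proof. by have [|m -> mmin] := @le_min [set x]; [exists x|exact: mmin]. Qed.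

Lemma wo_anti x y : le x y -> le y x -> x = y.
Proof. by apply: (proj2 le_wo). Qed.

Lemma wo_total x y : le x y \/ le y x.
Proof.
have [|m [->|->] mmin] := @le_min [set x; y]; first by exists x; left.
  by left; apply: mmin; right.
by right; apply: mmin; left.
Qed.

Lemma wo_trans y x z : le x y -> le y z -> le x z.
Proof.
move=> xy yz.
have [|m [[->|->]|->] mmin] := @le_min [set x; y; z].
- by exists x; left; left.
- by apply: mmin; right.
- by rewrite (@wo_anti x y)//; apply: mmin; left; left.
- rewrite -(@wo_anti y z)//; apply: mmin; left; right => //.
Qed.

Fact wo_leb_refl : reflexive leb.
Proof. by move=> x; apply/asboolP; exact: wo_refl. Qed.

Fact wo_leb_anti : antisymmetric leb.
Proof. by move=> x y /andP[/asboolP xy /asboolP yx]; exact: wo_anti. Qed.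

Fact wo_leb_trans : transitive leb.
Proof.
by move=> y x z /asboolP xy /asboolP yz; apply/asboolP; exact: wo_trans yz.
Qed.

HB.instance Definition _ := Order.Le_isPOrder.Build (Order.Disp tt tt) wo_type
  wo_leb_refl wo_leb_anti wo_leb_trans.

Fact wo_leb_total : total (<=%O : rel wo_type).
Proof.
move=> x y; apply/orP.
by case: (wo_total x y) => xy; [left|right]; apply/asboolP.
Qed.

HB.instance Definition _ :=
  Order.POrder_isTotal.Build (Order.Disp tt tt) wo_type wo_leb_total.

Lemma wo_type_well_order : well_order (<=%O : rel wo_type).
Proof.
move=> A [a Aa].
have [|m Am mmin] := @le_min [set x | x \in A]; first by exists a.
exists m; split; first by split => // x Ax; apply/asboolP; exact: mmin.
move=> m' [Am' m'min]; apply: wo_anti; first exact: mmin.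
by apply/asboolP; exact: m'min.
Qed.

End WellOrderedType.

Lemma continuous_to_order_topology (X : topologicalType) (d : Order.disp_t)
    (L : orderTopologicalType d) (f : X -> L) :
  (forall a, open [set x | (f x < a)%O]) ->
  (forall a, open [set x | (a < f x)%O]) -> continuous f.
Proof.
move=> olt ogt x U; rewrite itv_nbhsE => -[i [oi xi] iU].
suff oV : open (f @^-1` [set` i]).
  by apply: filterS (open_nbhs_nbhs (conj oV xi)) => y; exact: iU.
case: i oi {xi iU} => [[[]a|[]] [[]b|[]]] // _.
- rewrite (_ : _ @^-1` _ = [set x | (a < f x)%O] `&` [set x | (f x < b)%O]).
    exact: openI.
  by apply/seteqP; split=> y /=; rewrite in_itv /= => /andP.
- rewrite (_ : _ @^-1` _ = [set x | (a < f x)%O])//.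
  by apply/seteqP; split=> y /=; rewrite in_itv /= andbT.
- rewrite (_ : _ @^-1` _ = [set x | (f x < b)%O])//.
- rewrite (_ : _ @^-1` _ = setT); first exact: openT.
  by apply/seteqP; split=> y //=; rewrite in_itv.
Qed.

(** The greatest point [t] becomes [None] and the other points form [alpha]. The order isomorphism
    is continuous, and a continuous bijection from a compact to a Hausdorff space is a
    homeomorphism. *)
Lemma ordinal_like_compact_homeomorphic (X : topologicalType) :
  [set: X] !=set0 -> compact [set: X] -> ordinal_like [set: X] ->
  exists (d : Order.disp_t) (alpha : orderType d),
    [/\ well_order (<=%O : rel alpha),
        exists f : alpha -> X, injective f &
        homeomorphic X (order_topology (ordinal_succ alpha))].
Proof.
move=> [x0 _] X_cpt [le le_wo le_cl'].
have le_cl x : clopen [set y | le y x].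
  rewrite (_ : [set _ | _] = [set y | [set: X] y /\ le y x]).
    exact: le_cl'.
  by apply/seteqP; split=> y /=; tauto.
have [t tmax] : exists t, forall x, le x t.
  apply: contrapT => notop.
  (* Without a greatest point the final segments generate a proper filter; but the neighborhood
     [[set y | le y p]] of a cluster point [p] misses one of them. *)
  have FF : ProperFilter (filter_from [set: X] (fun x => [set y | ~ le y x])).
    apply: filter_from_proper; last first.
      move=> x _; apply: contrapT => nx; apply: notop; exists x => y.
      by apply: contrapT => nyx; apply: nx; exists y.
    apply: filter_from_filter; first by exists x0.
    move=> x y _ _; have [xy|yx] := wo_total le_wo x y.
      exists y => // z /= nzy; split => // zx; apply: nzy.
      exact: wo_trans zx xy.
    exists x => // z /= nzx; split => // zy; apply: nzx.
    exact: wo_trans zy yx.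
  have [|p [_ clp]] := X_cpt _ FF; first by exists x0.
  have [oV _] := le_cl p.
  have [||q [nqp qp]] := clp [set y | ~ le y p] [set y | le y p] => //.
    by exists p.
  by apply: open_nbhs_nbhs; split => //; exact: wo_refl.
pose S := {x : X | x != t}.
pose leS (u v : S) := le (val u) (val v).
have leS_wo : well_orders_on [set: S] leS.
  split=> [A _ [u Au]|u v _ _ uv vu]; last exact/val_inj/(wo_anti le_wo).
  have [|_ [m Am <-] mmin] := proj1 le_wo (val @` A) (@subsetT _ _).
    by exists (val u), u.
  by exists m => // v Av; apply: mmin; exists v.
pose alpha : orderType _ := wo_type leS_wo.
exists _, alpha; split; first exact: wo_type_well_order.
  by exists (val : S -> X); exact: val_inj.
pose L := order_topology (ordinal_succ alpha).
pose f (x : X) : L := (insub x : option S).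
pose g (u : L) : X := oapp (val : S -> X) t (u : option S).
have fK : cancel f g.
  move=> x; rewrite /f /g; case: insubP => [u _ ux|]; first exact: ux.
  by rewrite negbK => /eqP ->.
have gK : cancel g f.
  rewrite /f /g; case=> [u|] /=; first by rewrite valK.
  by rewrite insubN// eqxx.
have fle x y : (f x <= f y)%O = `[< le x y >].
  rewrite -[in RHS](fK x) -[in RHS](fK y).
  case: (f x) (f y) => [u|] [v|] //=.
  - by rewrite asboolT //=; exact: tmax.
  - rewrite asboolF //= => tv; have := valP v.
    by rewrite (@wo_anti _ _ le_wo (val v) t)// eqxx.
  - by rewrite asboolT //=; exact: tmax.
have cf : continuous f.
  apply: continuous_to_order_topology => a; rewrite -(gK a).
    (* An open lower ray is the union of the clopen segments at its own points. *)
    rewrite (_ : [set _ | _] =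
        \bigcup_(w in [set w | ~ le (g a) w]) [set y | le y w]).
      by apply: bigcup_open => w _; case: (le_cl w).
    apply/seteqP; split=> x /=.
      by rewrite ltNge fle => /asboolP ax; exists x => //; exact: wo_refl.
    move=> [w /= aw xw]; rewrite ltNge fle; apply/asboolP => ax; apply: aw.
    exact: wo_trans ax xw.
  rewrite (_ : [set _ | _] = ~` [set y | le y (g a)]).
    by apply: closed_openC; case: (le_cl (g a)).
  apply/seteqP; split=> x /=; first by rewrite ltNge fle => /asboolP.
  by rewrite ltNge fle => ?; apply/asboolP.
exists f, g; split => //.
apply/continuous_closedP => C clC.
rewrite (_ : g @^-1` C = f @` C).
  apply: compact_closed; first exact: order_hausdorff.
  apply: continuous_compact; first exact: continuous_subspaceT.
  exact: subclosed_compact clC X_cpt _.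
apply/seteqP; split=> [u Cgu|_ [x Cx <-]] /=; first by exists (g u).
by rewrite fK.
Qed.

Lemma countable_compact_ordinal (X : topologicalType) :
  [set: X] !=set0 -> hausdorff_space X -> compact [set: X] ->
  countable [set: X] ->
  exists (d : Order.disp_t) (alpha : orderType d),
    countable_ordinal alpha /\
    homeomorphic X (order_topology (ordinal_succ alpha)).
Proof.
move=> X0 X_haus X_cpt X_ctbl.
have [d [alpha [wo [f finj] hom]]] := ordinal_like_compact_homeomorphic
  X0 X_cpt (countable_compact_ordinal_like X_haus X_cpt X_ctbl).
exists d, alpha; split => //; split => //.
apply/countable_injP; have [e einj] := countable_injP _ X_ctbl.
by exists (e \o f) => u v _ _ /= /einj; rewrite !inE => /(_ I I)/finj.
Qed.

Lemma homeomorphic_LOTS_GO (X : topologicalType) (d : Order.disp_t)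
  (L : orderTopologicalType d) : homeomorphic X L -> GO_space X.
Proof.
move=> [f [g [cf cg fK gK]]]; exists d, L, setT.
pose i (u : L) : [set: L] := SigSub (mem_set I : u \in [set: L]).
have ci : continuous i.
  by apply/continuousP => _ [B oB <-]; rewrite -comp_preimage.
exists (i \o f), (g \o set_val); split.
- move=> x; apply: (@continuous_comp _ _ _ f i); [exact: cf|exact: ci].
- move=> u; apply: (@continuous_comp _ _ _ set_val g); last exact: cg.
  exact: initial_continuous.
- by move=> x /=; rewrite fK.
- by move=> u; apply: val_inj => /=; rewrite gK.
Qed.

(** * Countable successor ordinals are hereditarily GO *)

Section CountableSuccessor.
Context {d : Order.disp_t} {alpha : orderType d}.
Hypothesis alpha_ord : countable_ordinal alpha.
Local Notation L := (order_topology (ordinal_succ alpha)).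

Lemma ordinal_succ_min (A : set L) : A !=set0 ->
  exists2 m, A m & forall a, A a -> (m <= a)%O.
Proof.
move=> [u Au].
have [[a Aa]|na] := pselect (exists a : alpha, A (Some a)).
  have [|m [[+ mmin] _]] := proj1 alpha_ord [pred a | `[< A (Some a) >]].
    by exists a; apply/asboolP.
  move=> /asboolP Am; exists (Some m) => // -[b Ab|//].
  by apply: mmin; apply/asboolP.
case: u Au => [a Aa|AN]; first by exfalso; apply: na; exists a.
by exists None => // -[b Ab|//]; exfalso; apply: na; exists b.
Qed.

Lemma ordinal_succ_countable : countable [set: L].
Proof.
have [e einj] := countable_injP _ (proj2 alpha_ord).
apply/countable_injP; exists (fun u : option alpha => oapp (S \o e) 0%N u).
move=> [a|] [b|] _ _ //= [ab].
by rewrite (einj a b) ?inE.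
Qed.

(* An ultrafilter converges to the least [m] whose initial segment
   [set y | y <= m] it contains. *)
Lemma ordinal_succ_compact : compact [set: L].
Proof.
rewrite compact_ultra => F FU _.
have [|m Fm mmin] := @ordinal_succ_min [set m | F [set y | (y <= m)%O]].
  by exists None; apply: filterS filterT => -[].
exists m; split => // U; rewrite itv_nbhsE => -[i [oi mi] iU].
apply: filterS iU _.
have Fgt a : (a < m)%O -> F [set y | (a < y)%O].
  move=> am; have [Fa|] := in_ultra_setVsetC [set y | (y <= a)%O] FU.
    by have := mmin _ Fa; rewrite leNgt am.
  by apply: filterS => y /= /negP; rewrite ltNge.
have Fle b : (m < b)%O -> F [set y | (y < b)%O].
  by move=> mb; apply: filterS Fm => y /= /le_lt_trans; apply.
case: i oi mi => [[[]a|[]] [[]b|[]]] // _; rewrite in_itv /= ?andbT.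
- move=> /andP[am mb]; apply: filterS (filterI (Fgt _ am) (Fle _ mb)).
  by move=> y /= [ay yb]; rewrite in_itv /= ay.
- by move=> am; apply: filterS (Fgt _ am) => y /=; rewrite in_itv /= andbT.
- by move=> mb; apply: filterS (Fle _ mb) => y /=; rewrite in_itv.
- by move=> _; apply: filterS filterT => y _; rewrite /= in_itv.
Qed.

(** A Hausdorff image is again countable and compact, hence itself a successor ordinal and in
    particular a LOTS. *)
Lemma ordinal_succ_hereditarily_GO : hereditarily_GO_space L.
Proof.
split=> [|Y Y_haus [f cf fsurj]]; first exact: order_hausdorff.
have fT : f @` [set: L] = [set: Y].
  by apply/seteqP; split => // y _; exact: fsurj.
have [||||d' [beta [_ hom]]] := @countable_compact_ordinal Y.
- by exists (f None).
- by [].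
- rewrite -fT; apply: continuous_compact; last exact: ordinal_succ_compact.
  exact: continuous_subspaceT.
- rewrite -fT; apply: sub_countable ordinal_succ_countable.
  exact: card_image_le.
exact: homeomorphic_LOTS_GO hom.
Qed.

End CountableSuccessor.

(** * Non-GO images *)

(* The order that a GO-space inherits from an ambient LOTS; the strict order
   [x < y] is written [~~ le y x]. *)
Record GO_order (X : topologicalType) (le : rel X) : Prop := {
  go_anti : antisymmetric le;
  go_trans : transitive le;
  go_total : total le;
  go_rray_open : forall a, open [set x | ~~ le x a];
  go_lray_open : forall a, open [set x | ~~ le a x];
  go_convex : forall x U, nbhs x U -> exists V, [/\ open V, V x, V `<=` U &
    forall a b c, V a -> V c -> le a b -> le b c -> V b] }.

Lemma GO_order_dual (X : topologicalType) (le : rel X) :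
  GO_order le -> GO_order (fun x y => le y x).
Proof.
case=> anti trans tot ro lo cvx; split => //.
- by move=> x y; rewrite andbC; exact: anti.
- by move=> y x z xy yz; exact: trans yz xy.
- move=> x U /cvx[V [oV Vx VU Vcvx]]; exists V; split => // a b c Va Vc ba cb.
  exact: Vcvx Vc Va cb ba.
Qed.

(** The order of the ambient LOTS is pulled back along the embedding [phi]; preimages of intervals
    are convex. *)
Lemma GO_space_order (X : topologicalType) :
  GO_space X -> exists le : rel X, GO_order le.
Proof.
move=> [d [L [A [f [g [cf cg fK gK]]]]]].
pose phi x : L := set_val (f x).
have cphi : continuous phi.
  move=> x; apply: (@continuous_comp _ _ _ f set_val); first exact: cf.
  exact: initial_continuous.
have phi_inj : injective phi by move=> x y /val_inj/(can_inj fK).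
have ophi (B : set L) : open B -> open (phi @^-1` B).
  by move=> oB; apply: open_comp => // ? _; exact: cphi.
exists (fun x y => (phi x <= phi y)%O); split.
- by move=> x y /le_anti/phi_inj.
- by move=> y x z; exact: le_trans.
- by move=> x y; exact: le_total.
- move=> a; have := ophi _ (@rray_open _ _ (phi a)).
  congr open; apply/seteqP; split=> y /=; by rewrite in_itv /= andbT ltNge.
- move=> a; have := ophi _ (@lray_open _ _ (phi a)).
  congr open; apply/seteqP; split=> y /=; by rewrite in_itv /= ltNge.
move=> x U Ux.
have : nbhs (f x) (g @^-1` U) by apply: cg; rewrite fK.
rewrite nbhsE => -[_ [[B oB <-] Bfx] BU].
have : nbhs (phi x) B by apply: open_nbhs_nbhs; split.
rewrite itv_nbhsE => -[i [oi xi] iB].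
exists (phi @^-1` [set` i]); split => //.
- by apply: ophi; exact: itv_open_ends_open.
- by move=> y /= /iB By; rewrite -(fK y); apply: BU.
- case: i {oi xi iB} => l r a b c; rewrite /= !itv_boundlr.
  move=> /andP[ia _] /andP[_ ci] ab bc.
  by rewrite (le_trans ia) ?bnd_simp// (le_trans _ ci) ?bnd_simp.
Qed.

(* The space on [D] whose points other than [p] are isolated and where the
   neighborhoods of [p] are the sets in [F] that contain [p]. *)
Section FilterPoint.
Variables (D : choiceType) (p : D) (F : set_system D).
Context {FF : Filter F}.

(** The alias records [p] and the filter instance because its topology depends on them. *)
Definition filter_point : Type := let _ := (p, FF) in D.

Let op (A : set filter_point) := A p -> F A.

Fact filter_point_opT : op setT.
Proof. by move=> _; exact: filterT. Qed.

Fact filter_point_opI : setI_closed op.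
Proof. by move=> A B opA opB [/opA FA /opB FB]; exact: filterI. Qed.

Fact filter_point_op_bigU (I : Type) (f : I -> set filter_point) :
  (forall i, op (f i)) -> op (\bigcup_i f i).
Proof.
by move=> opf [i _ /opf]; apply: filterS => x fx; exists i.
Qed.

HB.instance Definition _ := Choice.copy filter_point D.
HB.instance Definition _ := isOpenTopological.Build filter_point
  filter_point_opT filter_point_opI filter_point_op_bigU.

Lemma filter_point_openE (A : set filter_point) : open A = (A p -> F A).
Proof. by []. Qed.

Hypothesis F_free : forall x, x <> p -> F (~` [set x]).

(** Every singleton other than that of [p] is clopen, and one of two distinct points differs from
    [p]. *)
Lemma filter_point_hausdorff : hausdorff_space filter_point.
Proof.
rewrite open_hausdorff => x y xy.
have sep (z : filter_point) : z <> p -> open [set z] /\ open (~` [set z]).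
  move=> zp; split; rewrite filter_point_openE; first by move=> /esym.
  by move=> _; exact: F_free.
have [xp|xp] := pselect (x = p).
  have [|oy oy'] := sep y.
    by move=> yp; move: xy; rewrite xp yp eqxx.
  exists (~` [set y], [set y]); first by split; apply/mem_set => //=; exact/eqP.
  by split => //; rewrite setICl.
have [ox ox'] := sep x xp.
exists ([set x], ~` [set x]).
  by split; apply/mem_set => //= yx; move: xy; rewrite yx eqxx.
by split => //; rewrite setICr.
Qed.

Lemma filter_point_GO_split (le : rel filter_point) : GO_order le ->
  ~` [set p] = [set x | ~~ le p x] `|` [set x | ~~ le x p].
Proof.
case=> anti _ tot _ _ _; apply/seteqP; split=> x /=.
  move=> xp; have [|] := orP (tot x p) => h.
    by left; apply/negP => px; apply: xp; apply: anti; rewrite h.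
  by right; apply/negP => px; apply: xp; apply: anti; rewrite h andbT.
have pp : le p p by case/orP: (tot p p).
by move=> [/negP h|/negP h] xp; apply: h; rewrite xp.
Qed.

End FilterPoint.
Arguments filter_point {D} p F {FF}.

Lemma GO_orderW (X : topologicalType) (le : rel X) : GO_order le ->
  forall x y, ~~ le x y -> le y x.
Proof. by move=> go x y; case/orP: (go_total go x y) => -> //. Qed.

Section GOOrderTheory.
Variables (X : topologicalType) (le : rel X).
Hypothesis go : GO_order le.

Lemma GO_refl x : le x x.
Proof. by case/orP: (go_total go x x). Qed.

Lemma GO_lt_trans x y z : ~~ le y x -> ~~ le z y -> ~~ le z x.
Proof.
move=> yx zy; apply/negP => zx; move/negP: zy; apply.
exact: (go_trans go) zx (GO_orderW go yx).
Qed.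

Lemma GO_le_lt_trans x y z : le x y -> ~~ le z y -> ~~ le z x.
Proof.
move=> xy zy; apply/negP => zx; move/negP: zy; apply.
exact: (go_trans go) zx xy.
Qed.

Lemma GO_lt_le_trans x y z : ~~ le y x -> le y z -> ~~ le z x.
Proof.
move=> yx yz; apply/negP => zx; move/negP: yx; apply.
exact: (go_trans go) yz zx.
Qed.

End GOOrderTheory.

Section Ultra.
Variable F : set_system nat.
Context {FU : UltraFilter F}.
Hypothesis F_free : forall n, F (~` [set n]).
Local Notation Y := (filter_point 0%N F).

Let ultra_point_left (le : rel Y) :
  GO_order le -> F [set x | ~~ le 0%N x] -> False.
Proof.
move=> go Fleft.
have Fgt q : ~~ le 0%N q -> F [set x | ~~ le x q].
  by move=> q0; have := go_rray_open go q; rewrite filter_point_openE; apply.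
pose S := {s : nat | ~~ le 0%N s}.
(* The sequence increases strictly on the left of the point. Stage [n] also passes the number [n] if
   that lies on the left, which makes the sequence cofinal there. *)
have step (ns : nat * S) : {ns' : nat * S | [/\ ns'.1 = ns.1.+1,
    ~~ le (val ns'.2) (val ns.2) &
    ~~ le 0%N ns.1 -> ~~ le (val ns'.2) ns.1]}.
  apply: cid; case: ns => n [s s0] /=.
  have Fn : F [set x | ~~ le 0%N n -> ~~ le x n].
    have [/Fgt|n0] := boolP (~~ le 0%N n).
      by apply: filterS => x /= ->.
    by apply: filterS filterT => x _ /=.
  have [x [[x0 xs] xn]] := filter_ex (filterI (filterI Fleft (Fgt _ s0)) Fn).
  by exists (n.+1, exist _ x x0).
have [s0 s0P] := filter_ex Fleft.
have [f [f0 fS]] := dependent_choice step (0%N, exist _ s0 s0P).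
have f1 n : (f n).1 = n.
  by elim: n => [|n IH]; [rewrite f0|case: (fS n) => -> _ _; rewrite IH].
pose s (n : nat) := val (f n).2.
have sleft n : ~~ le 0%N (s n) := valP (f n).2.
have sS n : ~~ le (s n.+1) (s n) by case: (fS n).
have slt m n : (m < n)%N -> ~~ le (s n) (s m).
  elim: n => // n IH; rewrite ltnS leq_eqVlt => /orP[/eqP ->//|/IH].
  by move=> smn; exact: (GO_lt_trans go) smn (sS n).
have scof q n : ~~ le 0%N q -> (q < n)%N -> ~~ le (s n) q.
  move=> q0 qn; have sq : ~~ le (s q.+1) q.
    by have [_ _] := fS q; rewrite f1; apply.
  move: qn; rewrite leq_eqVlt => /orP[/eqP <-//|/slt].
  by move=> slq; exact: (GO_lt_trans go) sq slq.
have sinj m n : s m = s n -> m = n.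
  by move=> smn; case: (ltngtP m n) => // /slt; rewrite smn (GO_refl go).
(* The even and the odd terms are disjoint cofinal subsequences, and [F] contains the complement of
   at least one of them. *)
suff key (E : set nat) : (forall q, exists2 m, (q < m)%N & E m) ->
    ~ F (~` (s @` E)).
  have [FE|] := in_ultra_setVsetC (s @` [set m | odd m]) FU.
    apply: (key [set m | ~~ odd m]).
      move=> q; exists (q.+1).*2; first by rewrite -addnn ltn_addr.
      by rewrite /= odd_double.
    apply: filterS FE => _ [m /= om <-] [n /= on /sinj nm].
    by move: on; rewrite nm om.
  apply: key => q; exists (q.*2).+1; last by rewrite /= odd_double.
  by rewrite ltnS -addnn leq_addr.
move=> Ecof FE.
have nb : nbhs (0%N : Y) (~` (s @` E)).
  apply: open_nbhs_nbhs; split; first by rewrite filter_point_openE.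
  move=> [m _ sm0]; have /negP := sleft m; rewrite sm0; apply.
  exact: (GO_refl go).
(* Since [V] is in [F], it contains some [q] on the left; by convexity it contains the terms between
   [q] and the point, although it avoids those indexed by [E]. *)
have [V [oV V0 VE Vcvx]] := go_convex go nb.
have FV : F V by move: oV; rewrite filter_point_openE; apply.
have [q [Vq q0]] := filter_ex (filterI FV Fleft).
have [m qm Em] := Ecof q.
suff : V (s m) by move/VE; apply; exists m.
apply: (Vcvx q _ 0%N) => //; first by have := GO_orderW go (scof _ _ q0 qm).
by have := GO_orderW go (sleft m).
Qed.

(* A side of the point on which [F] concentrates has countable cofinality, so
   it contains a sequence converging to the point; but an ultrafilter avoids
   the even or the odd terms. *)
Lemma ultra_point_not_GO : ~ GO_space Y.
Proof.
move=> /GO_space_order[le go].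
have := F_free 0%N; rewrite (filter_point_GO_split go) => FU0.
have [|FC] := in_ultra_setVsetC [set x | ~~ le 0%N x] FU.
  exact: ultra_point_left.
apply: (ultra_point_left (GO_order_dual go)).
by apply: filterS (filterI FU0 FC) => x /= [[]].
Qed.

End Ultra.

Lemma countable_setU (T : Type) (A B : set T) :
  countable A -> countable B -> countable (A `|` B).
Proof.
move=> cA cB.
rewrite (_ : _ `|` _ = \bigcup_(b in [set: bool]) (if b then A else B)).
  by apply: bigcup_countable => // -[].
apply/seteqP; split=> x; first by case=> h; [exists true|exists false].
by case=> -[] _ h; [left|right].
Qed.

Definition cofinite (D : Type) : set_system D := [set A | finite_set (~` A)].

Lemma cofinite_filter (D : Type) : Filter (@cofinite D).
Proof.
split; first by rewrite /cofinite /= setCT; exact: finite_set0.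
- by move=> A B; rewrite /cofinite /= setCI finite_setU.
- by move=> A B AB; apply: sub_finite_set; exact: subsetC.
Qed.
#[local] Existing Instance cofinite_filter.

Lemma cofinite_free (D : Type) (x : D) : cofinite (~` [set x]).
Proof. by rewrite /cofinite /= setCK; exact: finite_set1. Qed.

Section CofinitePoint.
Variables (D : choiceType) (p : D).
Local Notation Y := (filter_point p (@cofinite D)).

(* Initial segments of a side of [p] are finite, so every infinite sequence of
   the side is cofinal in it, and the side is countable. *)
Let cofinite_point_left (le : rel Y) : GO_order le ->
  countable [set x | ~~ le p x].
Proof.
move=> go; apply: contrapT => nctbl.
have fin q : ~~ le p q -> finite_set [set x | le x q].
  move=> qp; have := go_rray_open go q; rewrite filter_point_openE => /(_ qp).
  by rewrite /cofinite /=; apply: sub_finite_set => x /= ->.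
have : infinite_set [set x | ~~ le p x] by move/finite_set_countable.
move=> /infiniteP/pcard_surjP[g gsurj].
have /boolp.choice[q qP] n : exists q, ~~ le p q /\ g q = n.
  by have [q] := gsurj n I; exists q.
(* Without such a [y], the finite segments at the [q n] would cover the side. With it, the finite
   segment at [y] contains all [q n], which [g] tells apart. *)
have [y yp ynle] : exists2 y, ~~ le p y & forall n, ~ le y (q n).
  apply: contrapT => ny; apply: nctbl.
  apply: (@sub_countable _ _ _ (\bigcup_n [set x | le x (q n)])); last first.
    apply: bigcup_countable => [|n _]; first exact: countableP.
    by apply/finite_set_countable/fin; exact: (qP n).1.
  apply: subset_card_le => y /= yp; apply: contrapT => nyq; apply: ny.
  exists y => //.
  by move=> n yq; apply: nyq; exists n.
have : finite_set (range q).
  apply: sub_finite_set (fin y yp) => _ [n _ <-] /=.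
  by apply: (GO_orderW go); apply/negP; exact: ynle.
have : set_surj (range q) [set: nat] g.
  by move=> n _; exists (q n); [exists n|exact: (qP n).2].
move=> sg fq; apply: infinite_nat.
apply: sub_finite_set (finite_image g fq) => n _.
by have [x xq gx] := sg n I; exists x.
Qed.

Lemma cofinite_point_not_GO : ~ countable [set: D] -> ~ GO_space Y.
Proof.
move=> nctbl /GO_space_order[le go]; apply: nctbl.
have -> : [set: D] = ~` [set p] `|` [set p] by rewrite setUC setUv.
apply: countable_setU; last exact/finite_set_countable/finite_set1.
rewrite (filter_point_GO_split go); apply: countable_setU.
  exact: cofinite_point_left.
exact: (cofinite_point_left (GO_order_dual go)).
Qed.

End CofinitePoint.

(** * Chain condition and finiteness of open partitions *)

Section HereditarilyGO.
Variable X : topologicalType.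
Hypothesis X_GO : hereditarily_GO_space X.

Lemma hereditarily_GO_filter_point (D : choiceType) (p : D)
    (F : set_system D) (FF : Filter F) (h : X -> D) :
  (forall x, x <> p -> F (~` [set x])) -> (forall d, exists x, h x = d) ->
  (forall A : set D, (A p -> F A) -> open (h @^-1` A)) ->
  GO_space (filter_point p F).
Proof.
move=> F_free hsurj ho; apply: (proj2 X_GO).
  exact: filter_point_hausdorff.
exists (h : X -> filter_point p F).
  by apply/continuousP => A oA; apply: ho; move: oA; rewrite filter_point_openE.
by move=> d _; have [x hx] := hsurj d; exists x.
Qed.

(** Collapsing each [U i] to [i] and all remaining points to [p] would map [X] onto the one-point
    compactification of an uncountable discrete set. The preimage of a cofinite set containing [p]
    is the complement of finitely many clopen sets. *)
Lemma hereditarily_GO_clopen_ccc (T : choiceType) (E : set T) (U : T -> set X) :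
  trivIset E U -> (forall i, E i -> clopen (U i) /\ U i !=set0) -> countable E.
Proof.
move=> trivU clU; apply: contrapT => nctbl.
have [p0 Ep0] : E !=set0.
  apply/set0P/eqP => E0; apply: nctbl; rewrite E0.
  exact/finite_set_countable/finite_set0.
pose D : choiceType := {i : T | i \in E}.
pose p : D := exist _ p0 (mem_set Ep0).
have DE (i : D) : E (val i) by have := valP i; rewrite inE.
pose h x : D := xget p [set i : D | U (val i) x].
have hE i x : U (val i) x -> h x = i.
  move=> Ux; rewrite /h; case: xgetP => [j _ /= Ujx|/(_ i)//].
  by apply/val_inj/(trivU _ _ (DE j) (DE i)); exists x.
have hU x : h x <> p -> U (val (h x)) x.
  by rewrite /h; case: xgetP => [j -> //|].
have nctD : ~ countable [set: D].
  move=> ctD; apply: nctbl.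
  apply: (sub_countable _ (sub_countable (card_image_le val [set: D]) ctD)).
  by apply: subset_card_le => i Ei; exists (exist _ i (mem_set Ei)).
apply: (@cofinite_point_not_GO _ p nctD).
apply: (@hereditarily_GO_filter_point _ _ _ _ (h)).
- by move=> i _; exact: cofinite_free.
- by move=> i; have [_ [x Ux]] := clU _ (DE i); exists x; exact: hE.
move=> A FA; have [Ap|nAp] := pselect (A p).
  rewrite (_ : _ @^-1` _ = ~` \bigcup_(i in ~` A) U (val i)).
    apply: closed_openC; apply: closed_bigcup; first exact: FA.
    by move=> i _; case: (clU _ (DE i)) => -[].
  apply/seteqP; split=> x /= Ahx.
    by move=> [i nAi /hE hx]; apply: nAi; rewrite -hx.
  apply: contrapT => nAh; apply: Ahx; exists (h x) => //.
  by apply: hU => hp; apply: nAh; rewrite hp.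
rewrite (_ : _ @^-1` _ = \bigcup_(i in A) U (val i)).
  by apply: bigcup_open => i _; case: (clU _ (DE i)) => -[].
apply/seteqP; split=> x /=; last by move=> [i Ai /hE ->].
by move=> Ahx; exists (h x) => //; apply: hU => hp; apply: nAp; rewrite -hp.
Qed.

(** A map to [nat] with open fibers is continuous for every topology on [nat], in particular for
    that of a free ultrafilter point. *)
Lemma hereditarily_GO_no_infinite_partition (u : X -> nat) :
  (forall n, open (u @^-1` [set n])) -> finite_set (range u).
Proof.
move=> ou; apply: contrapT => /infiniteP/pcard_surjP[g gsurj].
have [F [FU coF]] := ultraFilterLemma eventually_filter.
have F_free n : F (~` [set n]).
  apply: coF; exists n.+1 => // m /= nm mn.
  by move: nm; rewrite mn ltnn.
apply: (ultra_point_not_GO F_free).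
apply: (@hereditarily_GO_filter_point _ _ _ _ (g \o u)) => //.
  by move=> n; have [_ [x _ <-] gx] := gsurj n I; exists x.
move=> A _.
rewrite (_ : _ @^-1` _ = \bigcup_(n in g @^-1` A) (u @^-1` [set n])).
  exact: bigcup_open.
by apply/seteqP; split=> x /=; [move=> ?; exists (u x)|move=> [n /= An ->]].
Qed.

End HereditarilyGO.

Lemma set_type_hausdorff (X : topologicalType) (A : set X) :
  hausdorff_space X -> hausdorff_space (set_type A).
Proof.
rewrite !open_hausdorff => hX x y xy.
have [|[U V] [/= Ux Vy] [oU oV /eqP UV0]] := hX (val x) (val y) _.
  by apply: contra xy => /eqP/val_inj ->.
exists (set_val @^-1` U, set_val @^-1` V); split => /=.
- by apply/mem_set; move: Ux; rewrite inE.
- by apply/mem_set; move: Vy; rewrite inE.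
- by exists U.
- by exists V.
- by rewrite -preimage_setI UV0 preimage_set0.
Qed.

(** * The circle is not a GO-space *)

Section Loop.
Local Open Scope ring_scope.
Variable R : realType.

(* A closed curve, [loop 0 = loop 1], without further double points on
   [0, 1]. *)
Definition loop (t : R) : R * R := (t * (1 - t), t * (1 - t) * (1 - 2 * t)).

Lemma loop_continuous : continuous loop.
Proof.
have c0 : continuous (fun t : R => 1 - t).
  by move=> t; apply: continuousB; [exact: cst_continuous|].
have c1 : continuous (fun t : R => t * (1 - t)).
  by move=> t; apply: cvgM; [exact: cvg_id|exact: c0].
have c2 : continuous (fun t : R => 1 - 2 * t).
  move=> t; apply: continuousB; first exact: cst_continuous.
  by apply: cvgM; [exact: cvg_cst|exact: cvg_id].
have c3 : continuous (fun t : R => t * (1 - t) * (1 - 2 * t)).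
  by move=> t; apply: cvgM; [exact: c1|exact: c2].
by move=> t; exact: cvg_pair (c1 t) (c3 t).
Qed.

(** The first coordinate vanishes at 0 and is positive on the middle third. *)
Lemma loop_neq0 u : 1 / 3 <= u <= 2 / 3 -> loop u <> loop 0.
Proof. by move=> /andP[u1 u2] [H _]; nra. Qed.

(** The second coordinate is at most 0 on this arc and positive at [1 / 3]. *)
Lemma loop_neq1 u : 2 / 3 <= u <= 1 -> loop u <> loop (1 / 3).
Proof.
move=> /andP[u1 u2] [_ H].
have : 0 <= u * (1 - u) * (2 * u - 1) by rewrite !mulr_ge0//; lra.
by lra.
Qed.

(** The second coordinate is at least 0 on this arc and negative at [2 / 3]. *)
Lemma loop_neq2 u : 0 <= u <= 1 / 3 -> loop u <> loop (2 / 3).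
Proof.
move=> /andP[u1 u2] [_ H].
have : 0 <= u * (1 - u) * (1 - 2 * u) by rewrite !mulr_ge0//; lra.
by lra.
Qed.

Definition loop_space := set_type (loop @` `[0, 1]%classic).

(* Of three points on a line one is the middle one, [lij] standing for
   [yi <= yj]; the last six hypotheses say that no [yi] separates the others. *)
Let no_middle (l01 l10 l02 l20 l12 l21 : bool) :
  l01 || l10 -> l02 || l20 -> l12 || l21 ->
  ~~ (l01 && l10) -> ~~ (l02 && l20) -> ~~ (l12 && l21) ->
  (~~ l01 -> ~~ l02) -> (~~ l02 -> ~~ l01) ->
  (~~ l12 -> ~~ l10) -> (~~ l10 -> ~~ l12) ->
  (~~ l20 -> ~~ l21) -> (~~ l21 -> ~~ l20) -> False.
Proof.
by case: l01; case: l10 => // _; case: l02; case: l20 => // _;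
  case: l12; case: l21 => // _ _ _ _; do ?[move=> /(_ isT)//|move=> _].
Qed.

(** The points at 0, [1 / 3] and [2 / 3] bound three arcs. Each arc is connected and avoids the
    third point, so its ends lie on the same side of that point, and none of the three can be the
    middle one. *)
Lemma loop_space_not_GO : ~ GO_space loop_space.
Proof.
move=> /GO_space_order[le go].
have pt t : 0 <= t <= 1 -> {y : loop_space | set_val y = loop t}.
  move=> t01; have lt : loop t \in loop @` `[0, 1]%classic.
    by apply/mem_set; exists t => //=; rewrite in_itv.
  by exists (SigSub lt).
have side (b y z : loop_space) (l r s t : R) : 0 <= l -> r <= 1 ->
    l <= s <= r -> l <= t <= r -> set_val y = loop s -> set_val z = loop t ->
    (forall u, l <= u <= r -> loop u <> set_val b) -> ~~ le b y -> ~~ le b z.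
  move=> l0 r1 sI tI yE zE nb yb.
  have [O1 oO1 O1E] := go_lray_open go b.
  have [O2 oO2 O2E] := go_rray_open go b.
  pose B := loop @` `[l, r]%classic.
  have cB : connected B.
    apply: connected_continuous_connected; first exact: segment_connected.
    by apply: continuous_subspaceT; exact: loop_continuous.
  have BY p : B p -> exists w : loop_space, [/\ set_val w = p,
      O1 p <-> ~~ le b w & O2 p <-> ~~ le w b].
    move=> [u /=]; rewrite in_itv /= => /andP[lu ur] <-.
    have [|w wE] := pt u; first by rewrite (le_trans l0 lu) (le_trans ur r1).
    exists w; rewrite -wE; split => //.
      by rewrite -[O1 _]/((set_val @^-1` O1) w) O1E.
    by rewrite -[O2 _]/((set_val @^-1` O2) w) O2E.
  have Bb p w : B p -> set_val w = p -> w <> b.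
    move=> [u /=]; rewrite in_itv /= => ulr <- wE wb.
    by apply: (nb u ulr); rewrite -wE wb.
  have Bs : B (loop s) by exists s => //=; rewrite in_itv.
  have Bt : B (loop t) by exists t => //=; rewrite in_itv.
  (* The part of the arc below [b] is relatively open by [O1], and relatively closed because [O2]
     cuts out its complement in the arc. *)
  suff BE : B `&` O1 = B.
    have [w [wE O1w _]] := BY _ Bt.
    have -> : z = w by apply: val_inj; exact: etrans zE (esym wE).
    by apply/O1w; move: Bt; rewrite -BE => -[].
  apply: cB.
  - exists (loop s); split => //; have [w [wE [_ O1w] _]] := BY _ Bs.
    apply: O1w; have -> // : w = y.
    by apply: val_inj; exact: etrans wE (esym yE).
  - by exists O1.
  - exists (~` O2); first exact: open_closedC.
    apply/seteqP; split=> p [Bp Op]; split => //;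
      have [w [wE [O1w wO1] [O2w wO2]]] := BY _ Bp.
      move=> /O2w; move: (O1w Op) => /negP bw /negP wb.
      by case/orP: (go_total go b w).
    apply: wO1; apply/negP => bw; apply: Op; apply: wO2; apply/negP => wb.
    by apply: (Bb _ _ Bp wE); apply: (go_anti go); rewrite bw wb.
have [y0 y0E] := pt 0 ltac:(lra).
have [y1 y1E] := pt 1 ltac:(lra).
(* The curve closes up, so the arc from [2 / 3] to 1 ends at [y0]. *)
have {y1 y1E}y0E' : set_val y0 = loop 1.
  by rewrite y0E /loop; congr pair; ring.
have [y1 y1E] := pt (1 / 3) ltac:(lra).
have [y2 y2E] := pt (2 / 3) ltac:(lra).
have n0 u : 1 / 3 <= u <= 2 / 3 -> loop u <> set_val y0.
  by rewrite y0E; exact: loop_neq0.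
have n1 u : 2 / 3 <= u <= 1 -> loop u <> set_val y1.
  by rewrite y1E; exact: loop_neq1.
have n2 u : 0 <= u <= 1 / 3 -> loop u <> set_val y2.
  by rewrite y2E; exact: loop_neq2.
have s012 := @side y0 _ _ (1/3) (2/3) (1/3) (2/3)
  ltac:(lra) ltac:(lra) ltac:(lra) ltac:(lra) y1E y2E n0.
have s021 := @side y0 _ _ (1/3) (2/3) (2/3) (1/3)
  ltac:(lra) ltac:(lra) ltac:(lra) ltac:(lra) y2E y1E n0.
have s120 := @side y1 _ _ (2/3) 1 (2/3) 1
  ltac:(lra) ltac:(lra) ltac:(lra) ltac:(lra) y2E y0E' n1.
have s102 := @side y1 _ _ (2/3) 1 1 (2/3)
  ltac:(lra) ltac:(lra) ltac:(lra) ltac:(lra) y0E' y2E n1.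
have s201 := @side y2 _ _ 0 (1/3) 0 (1/3)
  ltac:(lra) ltac:(lra) ltac:(lra) ltac:(lra) y0E y1E n2.
have s210 := @side y2 _ _ 0 (1/3) (1/3) 0
  ltac:(lra) ltac:(lra) ltac:(lra) ltac:(lra) y1E y0E n2.
have neq y y' : set_val y <> set_val y' -> ~~ (le y y' && le y' y).
  by move=> yy'; apply/negP => /(go_anti go) h; apply: yy'; rewrite h.
have := neq y0 y1; have := neq y0 y2; have := neq y1 y2.
have e01 : set_val y0 <> set_val y1.
  by move=> h; apply: (n1 1 ltac:(lra)); exact: etrans (esym y0E') h.
have e02 : set_val y0 <> set_val y2.
  by move=> h; apply: (n2 0 ltac:(lra)); exact: etrans (esym y0E) h.
have e12 : set_val y1 <> set_val y2 by rewrite y1E; apply: n2; lra.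
move=> /(_ e12) n12 /(_ e02) n02 /(_ e01) n01.
exact: no_middle (go_total go y0 y1) (go_total go y0 y2) (go_total go y1 y2)
  n01 n02 n12 s012 s021 s120 s102 s201 s210.
Qed.

Lemma hereditarily_GO_no_unit_itv_image (X : topologicalType) (f : X -> R) :
  hereditarily_GO_space X -> continuous f -> (forall x, 0 <= f x <= 1) ->
  (forall r, 0 <= r <= 1 -> exists x, f x = r) -> False.
Proof.
move=> [_ X_GO] cf f01 fsurj; apply: loop_space_not_GO.
have lf x : loop (f x) \in loop @` `[0, 1]%classic.
  by apply/mem_set; exists (f x) => //=; rewrite in_itv /= f01.
apply: X_GO; first by apply: set_type_hausdorff; exact: norm_hausdorff.
exists (fun x => SigSub (lf x) : loop_space).
  apply/continuousP => _ [B oB <-].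
  have := open_comp (f := loop \o f) (D := B) _ oB; apply => x _.
  by apply: continuous_comp; [exact: cf|exact: loop_continuous].
move=> [p pE] _; have := pE; rewrite inE => -[r /=].
rewrite in_itv /= => r01 rp.
have [x fx] := fsurj r r01; exists x => //.
by apply: val_inj; rewrite /= fx rp.
Qed.
End Loop.

(** * Monotone functions along a dense relation *)

Section DyadicFunction.
Local Open Scope ring_scope.
Variable R : realType.

Lemma dyadic_between (s r : R) : 0 <= s -> s < r -> r <= 1 ->
  exists n k, (k <= 2 ^ n)%N /\ s < k%:R / 2 ^+ n < r.
Proof.
move=> s0 sr r1.
(* By [n < 2 ^ n] the grid of mesh [1 / 2 ^ n] is finer than [r - s], so the first grid point after
   [s] is below [r]. *)
pose n := Num.truncn (r - s)^-1.
have rs0 : 0 < r - s by rewrite subr_gt0.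
have n0 : (0 : R) < 2 ^+ n by rewrite exprn_gt0.
have nP : 1 < (r - s) * 2 ^+ n.
  rewrite -ltr_pdivrMl// mulr1; apply: lt_le_trans (truncnS_gt _) _.
  by rewrite -natrX ler_nat ltn_expl.
pose k := (Num.truncn (s * 2 ^+ n)).+1.
have /andP[kl ku] := truncn_itv (mulr_ge0 s0 (ltW n0)).
have kr : k%:R < r * 2 ^+ n by rewrite /k -addn1 natrD; lra.
exists n, k; split.
  rewrite -(ler_nat R) natrX (le_trans (ltW kr))// ler_piMl//.
  exact: ltW.
by rewrite ltr_pdivlMr// ltr_pdivrMr// kr andbT.
Qed.

Lemma dyadic_ltE m n j k :
  (j%:R / 2 ^+ m < k%:R / 2 ^+ n :> R) = (j * 2 ^ n < k * 2 ^ m)%N.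
Proof.
rewrite ltr_pdivrMr ?exprn_gt0// mulrAC ltr_pdivlMr ?exprn_gt0//.
by rewrite -!natrX -!natrM ltr_nat.
Qed.

Variables (X : topologicalType) (le : rel X).
Hypothesis go : GO_order le.
Variables (ll : X -> X -> Prop) (a b : X).
Hypotheses (ll_lt : forall x y, ll x y -> ~~ le y x)
  (ll_dense : forall x y, ll x y -> exists z, ll x z /\ ll z y)
  (ll_ab : ll a b).

(* [g n k] is the point that will be sent to [k / 2 ^ n]. *)
Let dyadic_points : exists g : nat -> nat -> X,
  [/\ g 0%N 0%N = a, g 0%N 1%N = b,
      forall n k, g n.+1 k.*2 = g n k &
      forall n k, (k < 2 ^ n)%N -> ll (g n k) (g n k.+1)].
Proof.
have /boolp.choice[mid midP] (p : X * X) :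
    exists z, ll p.1 p.2 -> ll p.1 z /\ ll z p.2.
  have [/ll_dense[z zP]|nll] := pselect (ll p.1 p.2); first by exists z.
  by exists a => /nll.
(* Each level keeps the previous one at even indices and inserts intermediate points at odd ones. *)
pose g := fix g n k := match n with
  | 0%N => if k == 0%N then a else b
  | n'.+1 => if odd k then mid (g n' k./2, g n' k./2.+1) else g n' k./2 end.
exists g; split => //.
  by move=> n k /=; rewrite odd_double doubleK.
elim=> [|n IH] k kn /=; first by move: kn; rewrite expn0 ltnS leqn0 => /eqP ->.
have {kn} : (k./2 < 2 ^ n)%N.
  by rewrite ltn_half_double -mul2n -expnS.
move=> /IH kS; have [/= l r] := midP (g n k./2, g n k./2.+1) kS.
rewrite uphalf_half /=.
by case: (odd k).
Qed.

(** As in Urysohn's lemma, [f x] is the supremum of the dyadic numbers whose points lie below [x].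
    Open rays pull back to unions of order rays at the points [g n k], and every dyadic value in
    [0, 1] is attained. *)
Lemma dyadic_function : exists f : X -> R,
  [/\ continuous f, (forall x, 0 <= f x <= 1), f a = 0 /\ f b = 1,
      forall x y, le x y -> f x <= f y &
      forall s r, 0 <= s -> s < r -> r <= 1 -> exists y, s < f y < r].
Proof.
have [g [g0 g1 gdbl gS]] := dyadic_points.
have g_lt n j k : (j < k)%N -> (k <= 2 ^ n)%N -> ~~ le (g n k) (g n j).
  elim: k => // k IH; rewrite ltnS leq_eqVlt => /orP[/eqP -> kn|jk kn].
    exact/ll_lt/gS.
  exact: (GO_lt_trans go) (IH jk (ltnW kn)) (ll_lt (gS _ _ kn)).
have g_shift m n k : g (n + m)%N (k * 2 ^ m)%N = g n k.
  elim: m => [|m IH]; first by rewrite addn0 muln1.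
  by rewrite addnS expnS mulnCA mul2n gdbl.
have gd_lt m n j k : (k <= 2 ^ n)%N -> (j%:R / 2 ^+ m < k%:R / 2 ^+ n :> R) ->
    ~~ le (g n k) (g m j).
  rewrite dyadic_ltE => kn jk.
  rewrite -(g_shift m n) -(g_shift n m) [(m + n)%N]addnC; apply: g_lt => //.
  by rewrite expnD leq_mul2r kn orbT.
(* Adjoining 0 keeps the set nonempty for [x] below [a]. *)
pose S x := [set q : R | q = 0 \/ exists n k,
  [/\ (k <= 2 ^ n)%N, le (g n k) x & q = k%:R / 2 ^+ n]].
have S0 x : S x !=set0 by exists 0; left.
have dy01 n k : (k <= 2 ^ n)%N -> 0 <= (k%:R / 2 ^+ n : R) <= 1.
  move=> kn; rewrite divr_ge0// ?exprn_ge0//= ler_pdivrMr ?exprn_gt0// mul1r.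
  by rewrite -natrX ler_nat.
have ubS x : ubound (S x) 1.
  by move=> q [->|[n [k [kn _ ->]]]]; [exact: ler01|case/andP: (dy01 _ _ kn)].
have hS x : has_sup (S x) by split => //; exists 1.
pose f x := sup (S x).
have f_ge x n k : (k <= 2 ^ n)%N -> le (g n k) x -> k%:R / 2 ^+ n <= f x.
  by move=> kn gx; apply: sup_upper_bound => //; right; exists n, k.
have f_le x n k : (k <= 2 ^ n)%N -> le x (g n k) -> f x <= k%:R / 2 ^+ n.
  move=> kn xg; apply: ge_sup => // q [->|[m [j [jm gx ->]]]].
    by case/andP: (dy01 _ _ kn).
  rewrite leNgt; apply/negP => /(gd_lt _ _ _ _ jm) /negP; apply.
  exact: (go_trans go) gx xg.
have f_g n k : (k <= 2 ^ n)%N -> f (g n k) = k%:R / 2 ^+ n.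
  move=> kn; apply/eqP; rewrite eq_le.
  by rewrite (f_le _ _ _ kn (GO_refl go _)) (f_ge _ _ _ kn (GO_refl go _)).
have f_lt x n k : (k <= 2 ^ n)%N -> f x < k%:R / 2 ^+ n -> ~~ le (g n k) x.
  by move=> kn fx; apply/negP => /(f_ge _ _ _ kn); rewrite leNgt fx.
have f_gt x (r : R) : 0 <= r -> r < f x ->
    exists n k, [/\ (k <= 2 ^ n)%N, r < k%:R / 2 ^+ n & ~~ le x (g n k)].
  move=> r0 /(sup_gt (S0 x))[q [->|[n [k [kn gx ->]]]] rq].
    by move: rq; rewrite ltNge r0.
  (* A further dyadic number between [r] and [k / 2 ^ n] makes the inequality with [x] strict, as
     the open ray requires. *)
  have [|m [j [jm /andP[rj jk]]]] := dyadic_between r0 rq.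
    by case/andP: (dy01 _ _ kn).
  exists m, j; split => //; exact: (GO_lt_le_trans go) (gd_lt _ _ _ _ kn jk) gx.
have f01 x : 0 <= f x <= 1.
  by apply/andP; split; [apply: sup_upper_bound => //; left|exact: ge_sup].
exists f; split => //.
- apply: continuous_to_order_topology => r.
    have [r1|r1] := leP r 1; last first.
      rewrite (_ : [set _ | _] = setT); first exact: openT.
      apply/seteqP; split=> // x _ /=; apply: le_lt_trans r1.
      by case/andP: (f01 x).
    rewrite (_ : [set _ | _] = \bigcup_(nk in [set nk : nat * nat |
        (nk.2 <= 2 ^ nk.1)%N /\ nk.2%:R / 2 ^+ nk.1 < r])
        [set x | ~~ le (g nk.1 nk.2) x]).
      by apply: bigcup_open => nk _; exact: (go_lray_open go).
    apply/seteqP; split=> x /=.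
      move=> fr; have [f0 _] := andP (f01 x).
      have [n [k [kn /andP[fk kr]]]] := dyadic_between f0 fr r1.
      by exists (n, k) => //=; exact: f_lt.
    move=> [[n k] /= [kn kr] /(GO_orderW go) xg].
    exact: le_lt_trans (f_le _ _ _ kn xg) kr.
  have [r0|r0] := leP 0 r; last first.
    rewrite (_ : [set _ | _] = setT); first exact: openT.
    apply/seteqP; split=> // x _ /=; apply: lt_le_trans r0 _.
    by case/andP: (f01 x).
  rewrite (_ : [set _ | _] = \bigcup_(nk in [set nk : nat * nat |
      (nk.2 <= 2 ^ nk.1)%N /\ r < nk.2%:R / 2 ^+ nk.1])
      [set x | ~~ le x (g nk.1 nk.2)]).
    by apply: bigcup_open => nk _; exact: (go_rray_open go).
  apply/seteqP; split=> x /=.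
    by move=> /(f_gt _ _ r0)[n [k [kn rk kx]]]; exists (n, k).
  move=> [[n k] /= [kn rk] /(GO_orderW go) gx].
  exact: lt_le_trans rk (f_ge _ _ _ kn gx).
- by rewrite -g0 -g1 !f_g// expr0 mul0r divr1.
- move=> x y xy; apply: ge_sup => // q [->|[n [k [kn gx ->]]]].
    by case/andP: (f01 y).
  by apply: f_ge => //; exact: (go_trans go) gx xy.
- move=> s r s0 sr r1; have [n [k [kn skr]]] := dyadic_between s0 sr r1.
  by exists (g n k); rewrite f_g.
Qed.

End DyadicFunction.

(** * Hereditarily GO-spaces are countable and compact *)

Section HereditarilyGOOrder.
Variable X : topologicalType.
Hypothesis X_GO : hereditarily_GO_space X.

Lemma hereditarily_GO_order : exists le : rel X, GO_order le.
Proof.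
apply: GO_space_order; apply: (proj2 X_GO); first exact: (proj1 X_GO).
by exists id => //; move=> x ?.
Qed.

(** The least index of a set containing [x] is a locally constant function of [x], so it takes
    finitely many values. *)
Lemma hereditarily_GO_clopen_cover (A : nat -> set X) :
  (forall n, clopen (A n)) -> (forall x, exists n, A n x) ->
  exists N, forall x, exists2 n, (n <= N)%N & A n x.
Proof.
move=> clA covA.
have /boolp.choice[u uP] x : exists n, A n x /\ forall m, A m x -> (n <= m)%N.
  have exA : exists n, `[< A n x >].
    by have [n An] := covA x; exists n; apply/asboolP.
  case: (ex_minnP exA) => n /asboolP An nmin.
  by exists n; split => // m Am; apply: nmin; apply/asboolP.
have ou n : open (u @^-1` [set n]).
  rewrite (_ : _ @^-1` _ = seqDU A n).
    rewrite /seqDU setDE; apply: openI; first by case: (clA n).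
    by apply: closed_openC; case: (clopen_bigsetU n clA).
  rewrite /seqDU -bigcup_mkord; apply/seteqP; split=> x /=.
    move=> ux; have [Au umin] := uP x; rewrite -ux; split => // -[m /= mn Am].
    by move: mn; rewrite ltnNge umin.
  move=> [An nA]; have [Au umin] := uP x; apply/eqP.
  rewrite eqn_leq umin// leqNgt; apply/negP => un.
  by apply: nA; exists (u x).
have /finite_seqP[s sE] := hereditarily_GO_no_infinite_partition X_GO ou.
exists (\max_(i <- s) i) => x; exists (u x); last by case: (uP x).
apply: (@leq_bigmax_seq _ _ xpredT id) => //.
by have : [set` s] (u x) by rewrite -sE; exists x.
Qed.

Definition initial_segment (le : rel X) (J : set X) :=
  forall x y, J y -> le x y -> J x.

Lemma missed_value_clopen (R : realType) (le : rel X) (f : X -> R) (r : R) :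
  continuous f -> (forall x y, le x y -> (f x <= f y)%R) ->
  (forall x, f x <> r) ->
  clopen [set x | (f x < r)%R] /\ initial_segment le [set x | (f x < r)%R].
Proof.
move=> cf fmono nr; split; last by move=> x y /= fy /fmono /le_lt_trans; apply.
split.
  apply: (open_comp (D := [set y | (y < r)%R])); last exact: open_lt.
  by move=> x _; exact: cf.
rewrite (_ : [set _ | _] = f @^-1` [set y | (y <= r)%R]).
  by apply: preimage_closed => //; exact: closed_le.
apply/seteqP; split=> x /=; first exact: ltW.
by rewrite le_eqVlt => /orP[/eqP/nr|].
Qed.

Section Order.
Variable le : rel X.
Hypothesis go : GO_order le.

Lemma hereditarily_GO_missed_value (f : X -> Rdefinitions.R) :
  continuous f -> (forall x, 0 <= f x <= 1)%R -> exists2 r, (0 <= r <= 1)%R &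
  forall x, f x <> r.
Proof.
move=> cf f01; apply: contrapT => nr.
apply: (hereditarily_GO_no_unit_itv_image X_GO cf f01) => r r01.
apply: contrapT => nx; apply: nr; exists r => // x fx.
by apply: nx; exists x.
Qed.

(** Without such a cut the strict order between [a] and [b] is dense and yields a monotone function
    from 0 at [a] to 1 at [b]; a value that it misses provides the cut after all. *)
Lemma hereditarily_GO_clopen_cut a b : ~~ le b a ->
  exists J, [/\ clopen J, initial_segment le J, J a & ~ J b].
Proof.
move=> ab; apply: contrapT => nJ.
pose ll x y := [/\ le a x, ~~ le y x & le y b].
have ll_dense x y : ll x y -> exists z, ll x z /\ ll z y.
  move=> [ax xy yb]; apply: contrapT => nz.
  have between z : ~~ le z x -> ~~ le y z -> False.
    move=> xz zy; apply: nz; exists z; split; split => //.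
      exact: (go_trans go) (GO_orderW go zy) yb.
    exact: (go_trans go) ax (GO_orderW go xz).
  (* With nothing between [x] and [y], the open rays below [y] and above [x] are complementary. *)
  have JE : [set z | ~~ le y z] = ~` [set z | ~~ le z x].
    apply/seteqP; split=> z /= h; first by move=> zx; exact: (between z).
    apply/negP => yz; apply: h; exact: (GO_lt_le_trans go) xy yz.
  apply: nJ; exists [set z | ~~ le y z]; split.
  - split; first exact: (go_lray_open go).
    by rewrite JE; apply: open_closedC; exact: (go_rray_open go).
  - by move=> u v /= vy uv; exact: (GO_le_lt_trans go) uv vy.
  - exact: (GO_le_lt_trans go) ax xy.
  - by rewrite /= yb.
have ll_lt x y : ll x y -> ~~ le y x by case.
have ll_ab : ll a b by split => //; exact: (GO_refl go).
have [f [cf f01 [fa fb] fmono _]] :=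
  @dyadic_function Rdefinitions.R _ _ go ll a b ll_lt ll_dense ll_ab.
have [r /andP[r0 r1] nr] := hereditarily_GO_missed_value cf f01.
have [clJ inJ] := missed_value_clopen cf fmono nr.
apply: nJ; exists [set x | (f x < r)%R]; split => //=.
  by rewrite fa lt_neqAle r0 andbT; apply/eqP => r0'; apply: (nr a); rewrite fa.
by rewrite fb ltNge r1.
Qed.

(** Let [r] be a missed value of the monotone function. Clopen cuts between points whose values
    increase to [r], together with the clopen set of larger values, cover [X] without a finite
    subcover. *)
Lemma hereditarily_GO_not_dense (ll : X -> X -> Prop) :
  (forall x y, ll x y -> ~~ le y x) ->
  (forall x y, ll x y -> exists z, ll x z /\ ll z y) ->
  forall a b, ~ ll a b.
Proof.
move=> ll_lt ll_dense a b ll_ab.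
have [f [cf f01 [fa fb] fmono fdense]] :=
  @dyadic_function Rdefinitions.R _ _ go ll a b ll_lt ll_dense ll_ab.
have [r /andP[r0 r1] nr] := hereditarily_GO_missed_value cf f01.
have {}r0 : (0 < r)%R.
  by rewrite lt_neqAle r0 andbT; apply/eqP => r0'; apply: (nr a); rewrite fa.
have [[oJ cJ] _] := missed_value_clopen cf fmono nr.
have flt x y : (f x < f y)%R -> ~~ le y x.
  by move=> fxy; apply/negP => /fmono; rewrite leNgt fxy.
(* These levels increase strictly from 0 to the limit [r]. *)
pose s (n : nat) : Rdefinitions.R := (r - r / n.+1%:R)%R.
have sS n : (s n < s n.+1)%R.
  by rewrite ltrD2l ltrN2 ltr_pM2l// ltf_pV2 ?posrE ?ltr0n// ltr_nat.
have s_ge0 n : (0 <= s n)%R.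
  by rewrite subr_ge0 ler_pdivrMr ?ltr0n// ler_peMr ?ler1n// ltW.
have s_ltr n : (s n < r)%R by rewrite ltrBlDr ltrDl divr_gt0 ?ltr0n.
have s_lim x : (x < r)%R -> exists n, (x < s n)%R.
  rewrite -subr_gt0 => xr; exists (Num.truncn (r / (r - x)))%R.
  have := truncnS_gt (r / (r - x))%R; rewrite ltr_pdivrMr// => h.
  by rewrite /s ltrBrDr addrC -ltrBrDr ltr_pdivrMr ?ltr0n// mulrC.
have /boolp.choice[y yP] n : exists y, (s n < f y < s n.+1)%R.
  apply: fdense => //; exact: le_trans (ltW (s_ltr _)) r1.
have ylt n : ~~ le (y n.+1) (y n).
  apply: flt; have /andP[_ h1] := yP n; have /andP[h2 _] := yP n.+1.
  exact: lt_trans h1 h2.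
have /boolp.choice[J JP] n := hereditarily_GO_clopen_cut (ylt n).
have [N NP] : exists N, forall x, exists2 n, (n <= N)%N &
    (if n is m.+1 then J m else ~` [set x | (f x < r)%R]) x.
  apply: hereditarily_GO_clopen_cover.
    move=> [|n]; last by case: (JP n).
    by split; [exact: closed_openC|exact: open_closedC].
  move=> x; have [fx|fx] := pselect (f x < r)%R; last by exists 0%N.
  have [n xn] := s_lim _ fx; exists n.+1; have [_ inJ Jy _] := JP n.
  apply: inJ Jy _; apply: (GO_orderW go); apply: flt; apply: lt_trans xn _.
  by case/andP: (yP n).
have JS m n : (m <= n)%N -> ~ J m (y n.+1).
  move=> mn Jm; have [_ inJ _] := JP m; apply; apply: inJ Jm _.
  elim: n mn => [|n IH]; first by rewrite leqn0 => /eqP ->; exact: (GO_refl go).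
  rewrite leq_eqVlt => /orP[/eqP ->|]; first exact: (GO_refl go).
  rewrite ltnS => /IH h; exact: (go_trans go) h (GO_orderW go (ylt _)).
(* The point [y N.+1] lies beyond every [J m] with [m <= N] and has a value below [r], so it escapes
   the finite subcover. *)
have [[|m] mN] := NP (y N.+1); last by apply: JS; exact: ltnW.
apply => /=; apply: lt_trans (s_ltr N.+2); by case/andP: (yP N.+1).
Qed.

(* The next-element gaps of a well-ordered cofinal subset give pairwise disjoint
   nonempty clopen sets. *)
Lemma hereditarily_GO_countable_cofinal (E : set X) :
  exists W, [/\ countable W, W `<=` E &
    forall z, E z -> exists2 w, W w & le z w].
Proof.
have [[m Em mmax]|nomax] := pselect (exists2 m, E m & forall z, E z -> le z m).
  exists [set m]; split; first exact/finite_set_countable/finite_set1.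
    by move=> _ ->.
  by move=> z Ez; exists m => //; exact: mmax.
have above z : E z -> exists2 v, E v & ~~ le v z.
  move=> Ez; apply: contrapT => nv; apply: nomax; exists z => // v Ev.
  by apply: contrapT => /negP h; apply: nv; exists v.
have [Rw Rw_wo] := well_ordering_principle X.
have Rmin (A : set X) : A !=set0 -> exists2 m, A m & forall x, A x -> Rw m x.
  move=> [x Ax]; have [|m [[Am mmin] _]] := Rw_wo [pred x | `[< A x >]].
    by exists x; apply/asboolP.
  by exists m; [exact/asboolP|move=> y Ay; apply: mmin; apply/asboolP].
have Rrefl x : Rw x x.
  by have [|m -> mmin] := Rmin [set x]; [exists x|exact: mmin].
have Ranti x y : Rw x y -> Rw y x -> x = y.
  move=> xy yx; have [|m [_ muniq]] := Rw_wo (pred2 x y).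
    by exists x; rewrite inE eqxx.
  rewrite -(muniq x) ?(muniq y)//; split; rewrite ?inE ?eqxx ?orbT//.
    by move=> z; rewrite !inE => /orP[/eqP ->|/eqP ->].
  by move=> z; rewrite !inE => /orP[/eqP ->|/eqP ->].
(* [W] consists of the points of [E] above all [Rw]-earlier points of [E]. On [W] the orders [le]
   and [Rw] agree. *)
pose W := [set x | E x /\ forall y, E y -> Rw y x -> y <> x -> ~~ le x y].
have Wcof z : E z -> exists2 w, W w & le z w.
  move=> Ez; have [|w [Ew zw] wmin] := Rmin [set x | E x /\ le z x].
    by exists z; split => //; exact: (GO_refl go).
  exists w => //; split => // y Ey yw ynw.
  have [zy|] := boolP (le z y).
    by exfalso; apply: ynw; apply: Ranti => //; exact: wmin.
  by move=> yz; exact: (GO_lt_le_trans go) yz zw.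
exists W; split => //; last by move=> x [].
(* [nx w] is the successor of [w] in [W]. *)
have /boolp.choice[nx nxP] w : exists v, W w ->
    [/\ W v, ~~ le v w & forall v', W v' -> ~~ le v' w -> le v v'].
  have [Ww|nW] := pselect (W w); last by exists w.
  have [|v [Wv wv] vmin] := Rmin [set v | W v /\ ~~ le v w].
    have [v Ev wv] := above w (proj1 Ww); have [v' Wv' vv'] := Wcof v Ev.
    by exists v'; split => //; exact: (GO_lt_le_trans go) wv vv'.
  exists v => _; split => // v' Wv' wv'.
  have [->|/eqP vv'] := eqVneq v v'; first exact: (GO_refl go).
  apply: (GO_orderW go); have [_ ] := Wv'; apply => //; first by case: Wv.
  exact: vmin.
have /boolp.choice[J JP] w : exists J, W w ->
    [/\ clopen J, initial_segment le J, J w & ~ J (nx w)].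
  have [Ww|nW] := pselect (W w); last by exists setT.
  by have [_ /hereditarily_GO_clopen_cut[J ?] _] := nxP w Ww; exists J.
apply: (hereditarily_GO_clopen_ccc X_GO (U := fun w => J (nx w) `\` J w)).
  (* For [w] before [v], [J (nx w)] lies inside [J v], although the cuts are chosen independently:
     either [nx w = v], or points of [J (nx w)] lie below [nx (nx w)], which is at most [v]. *)
  have key w v x : W w -> W v -> ~~ le v w -> J (nx w) x -> ~ J v x -> False.
    move=> Ww Wv wv Jx; apply.
    have [Wn _ nmin] := nxP w Ww; have [_ inJ Jv _] := JP v Wv.
    have := nmin v Wv wv; have [<- //|/eqP nwv nwlev] := eqVneq (nx w) v.
    have vn : ~~ le v (nx w).
      by apply/negP => h; apply: nwv; apply: (go_anti go); rewrite h nwlev.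
    have [Wnn _ nnmin] := nxP _ Wn; have [_ inJn _ nJ] := JP _ Wn.
    apply: inJ Jv _; apply: (go_trans go) (nnmin v Wv vn).
    by apply: (GO_orderW go); apply/negP => h; apply: nJ; exact: inJn Jx h.
  move=> w v Ww Wv [x [[Jnw nJw] [Jnv nJv]]].
  apply: (go_anti go); apply/andP; split; apply: contrapT => /negP h.
    exact: key Wv Ww h Jnv nJw.
  exact: key Ww Wv h Jnw nJv.
move=> w Ww; have [Wn _ _] := nxP w Ww.
have [clJ _ _ nJ] := JP w Ww; have [clJn _ Jn _] := JP _ Wn; split.
  by rewrite setDE; apply: clopenI => //; exact: clopenC.
by exists (nx w).
Qed.

(** The countable intervals from [x] to the points of a countable cofinal subset cover the set. *)
Lemma hereditarily_GO_countable_up x :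
  countable [set y | le x y /\ countable [set z | le x z /\ le z y]].
Proof.
set E := [set y | _].
have [W [cW WE Wcof]] := hereditarily_GO_countable_cofinal E.
apply: (@sub_countable _ _ _ (\bigcup_(w in W) [set z | le x z /\ le z w])).
  apply: subset_card_le => y Ey; have [w Ww yw] := Wcof y Ey.
  by exists w => //; case: Ey.
by apply: bigcup_countable => // w /WE[].
Qed.

(** If [V] has a point [a] below [x], a clopen cut between them bounds [A]. Otherwise the closed
    upper ray at [x] is open, being the union of [V] and an open ray. *)
Lemma hereditarily_GO_half_nbhs x V : open V -> V x ->
  (forall a b c, V a -> V c -> le a b -> le b c -> V b) ->
  exists A, [/\ clopen A, A x & forall y, A y -> le y x -> V y].
Proof.
move=> oV Vx Vcvx.
have [[a Va ax]|na] := pselect (exists2 a, V a & ~~ le x a).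
  have [J [clJ inJ Ja nJx]] := hereditarily_GO_clopen_cut ax.
  exists (~` J); split => //; first exact: clopenC.
  move=> y nJy yx; apply: Vcvx Va Vx _ yx; apply: (GO_orderW go).
  by apply/negP => ya; apply: nJy; exact: inJ Ja ya.
exists [set y | le x y]; split; last 2 first.
- exact: (GO_refl go).
- move=> y /= xy yx; rewrite (_ : y = x)//.
  by apply: (go_anti go); rewrite xy yx.
split.
  rewrite (_ : [set _ | _] = V `|` [set y | ~~ le y x]).
    by apply: openU => //; exact: (go_rray_open go).
  apply/seteqP; split=> y /=.
    move=> xy; have [yx|] := boolP (le y x); last by right.
    by left; rewrite (_ : y = x)//; apply: (go_anti go); rewrite xy yx.
  move=> [Vy|/(GO_orderW go)//]; apply: contrapT => /negP xy; apply: na.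
  by exists y.
rewrite (_ : [set _ | _] = ~` [set y | ~~ le x y]).
  by apply: open_closedC; exact: (go_lray_open go).
by apply/seteqP; split=> y /= => [->//|/negP]; rewrite negbK.
Qed.

End Order.

Lemma hereditarily_GO_countable : countable [set: X].
Proof.
have [le go] := hereditarily_GO_order.
pose I x y := [set z | le x z /\ le z y].
have up x := hereditarily_GO_countable_up go x.
have down y : countable [set x | le x y /\ countable (I x y)].
  have := hereditarily_GO_countable_up (GO_order_dual go) y; congr countable.
  apply/seteqP; split=> x [xy cI]; split => //; move: cI; congr countable;
    by apply/seteqP; split=> z [? ?].
have Ictbl x y : countable (I x y).
  have [xy|yx] := boolP (le x y); last first.
    rewrite (_ : I x y = set0); first exact/finite_set_countable/finite_set0.
    apply/seteqP; split=> // z [xz zy]; move/negP: yx; apply.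
    exact: (go_trans go) xz zy.
  apply: contrapT => nI.
  (* This relation is dense: otherwise every [z] in [I u v] has [I u z] or [I z v] countable, and by
     [up] and [down] there are only countably many such [z]. *)
  pose ll u v := le u v /\ ~ countable (I u v).
  apply: (@hereditarily_GO_not_dense _ go ll _ _ x y) => // u v [uv nuv].
    apply/negP => vu; apply: nuv.
    apply: (sub_countable (subset_card_le _)
      (finite_set_countable (finite_set1 u))).
    move=> z [uz zv]; apply: (go_anti go); rewrite uz andbT.
    exact: (go_trans go) zv vu.
  apply: contrapT => nz; apply: nuv.
  apply: (sub_countable (subset_card_le _) (countable_setU (up u) (down v))).
  move=> z [uz zv].
  have [cuz|nuz] := pselect (countable (I u z)); first by left.
  have [czv|nzv] := pselect (countable (I z v)); first by right.
  by exfalso; apply: nz; exists z.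
have [[x0]|nX] := pselect ([set: X] !=set0); last first.
  rewrite (_ : [set: X] = set0); first exact/finite_set_countable/finite_set0.
  by apply/seteqP; split=> // x _; exfalso; apply: nX; exists x.
move=> _.
apply: (sub_countable (subset_card_le _) (countable_setU (up x0) (down x0))).
move=> y _.
have [xy|/(GO_orderW go) yx] := boolP (le x0 y); [left|right]; split => //.
exact: Ictbl.
Qed.

Lemma hereditarily_GO_clopen_base : has_clopen_base X.
Proof.
have [le go] := hereditarily_GO_order.
move=> x U /(go_convex go)[V [oV Vx VU Vcvx]].
have [A [clA Ax AV]] := hereditarily_GO_half_nbhs go oV Vx Vcvx.
have [|B [clB Bx BV]] := hereditarily_GO_half_nbhs (GO_order_dual go) oV Vx _.
  by move=> a b c Va Vc ba cb; exact: Vcvx Vc Va cb ba.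
exists (A `&` B); split => //; first exact: clopenI.
move=> y [Ay By]; apply: VU.
by case/orP: (go_total go x y) => [xy|yx]; [exact: BV|exact: AV].
Qed.

(** If an ultrafilter does not converge, every point has a clopen neighborhood outside it. These
    form a countable cover, and finitely many of them cannot cover [X], since their complements are
    in the ultrafilter. *)
Lemma hereditarily_GO_compact : compact [set: X].
Proof.
rewrite compact_ultra => F FU _; apply: contrapT => ncvg.
have /boolp.choice[V VP] x : exists V, [/\ clopen V, V x & ~ F V].
  apply: contrapT => nV; apply: ncvg; exists x; split => // U.
  move=> /hereditarily_GO_clopen_base[V [clV Vx VU]].
  apply: filterS VU _; apply: contrapT => nFV; apply: nV.
  by exists V.
have [e einj] := countable_injP _ hereditarily_GO_countable.
have /boolp.choice[A AP] n : exists A, [/\ clopen A, ~ F A &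
    forall x, e x = n -> A x].
  have [[x ex]|nx] := pselect (exists x, e x = n).
    have [clV Vx nFV] := VP x; exists (V x); split => // y ey.
    by rewrite (einj y x) ?inE// ex ey.
  exists set0; split; [exact: clopen0|exact: filter_not_empty|].
  by move=> x ex; apply: nx; exists x.
have [||N NP] := @hereditarily_GO_clopen_cover A.
- by move=> n; case: (AP n).
- by move=> x; exists (e x); case: (AP (e x)) => _ _; exact.
have FN M : F [set x | forall n, (n <= M)%N -> ~ A n x].
  have FnA n : F (~` A n).
    by have [//|] := in_ultra_setVsetC (A n) FU; case: (AP n).
  elim: M => [|M IH].
    by apply: filterS (FnA 0%N) => x nA n; rewrite leqn0 => /eqP ->.
  apply: filterS (filterI IH (FnA M.+1)) => x [nA nAM] n.
  by rewrite leq_eqVlt ltnS => /orP[/eqP ->//|]; exact: nA.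
have [x nA] := filter_ex (FN N).
by have [n nN An] := NP x; exact: (nA n).
Qed.

End HereditarilyGOOrder.

Theorem theorem1p1 :
  (forall X : topologicalType,
     [set: X] !=set0 -> hereditarily_GO_space X ->
     exists (d : Order.disp_t) (alpha : orderType d),
       countable_ordinal alpha /\
       homeomorphic X (order_topology (ordinal_succ alpha)))
  /\
  (forall (d : Order.disp_t) (alpha : orderType d),
     countable_ordinal alpha ->
     hereditarily_GO_space (order_topology (ordinal_succ alpha))).
Proof.
split=> [X X0 X_GO|d alpha]; last exact: ordinal_succ_hereditarily_GO.
apply: countable_compact_ordinal => //; first by case: X_GO.
  exact: hereditarily_GO_compact.
exact: hereditarily_GO_countable.
Qed.
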